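(* Let $t\ge 1$ and let $\Lambda\subset\mathbb{R}^N$ be a self-similar arc associated to contractive similitudes $S_1,\dots,S_\ell$, of Hausdorff dimension $s>1$. Then $\Lambda$ is a $t$-quasi-arc if and only if $\Lambda$ satisfies Condition $Q_p^t$ for every $p=1,\dots,\ell-1$.
   Context: A contractive similitude with ratio $r\in(0,1)$ is a map $S:\mathbb{R}^N\to\mathbb{R}^N$ with $|S(x)-S(y)|=r|x-y|$ for all $x,y$. Given contractive similitudes $S_1,\dots,S_\ell$, the associated self-similar set is the unique nonempty compact set $\Lambda$ with $\Lambda=\bigcup_{i=1}^{\ell}S_i(\Lambda)$. It is called a self-similar arc if $\Lambda$ is an arc (a homeomorphic image of $[0,1]$) and (1) $S_i(\Lambda)\cap S_j(\Lambda)$ is a singleton whenever $|i-j|=1$; (2) $S_i(\Lambda)\cap S_j(\Lambda)=\emptyset$ whenever $|i-j|>1$. Order: let $h:[0,1]\to\Lambda$ be a homeomorphism with $h(0)\in S_1(\Lambda)$. Write $x\prec y$ if $h^{-1}(x)<h^{-1}(y)$ (and $x\preceq y$ for the non-strict order), and $[x,y]=\{z\in\Lambda: x\preceq z\preceq y\}$. There are points $z_0\prec z_1\prec\dots\prec z_\ell$ (the vertices) such that $S_j(\Lambda)=[z_{j-1},z_j]$ for $j=1,\dots,\ell$. For $x,y\in\Lambda$, $\Lambda(x,y)$ is the subarc of $\Lambda$ between $x$ and $y$, and $|\Lambda(x,y)|$ is its diameter. $\Lambda$ is a $t$-quasi-arc if there is a constant $\lambda>0$ with $|\Lambda(x,y)|^t\le\lambda|x-y|$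 for all $x,y\in\Lambda$. For $1\le p\le\ell-1$, $\Lambda$ satisfies Condition $Q_p^t$ if there is a constant $C_p>0$ such that $|\Lambda(x,y)|^t\le C_p|x-y|$ whenever $z_{p-1}\preceq x\preceq z_p\preceq y\preceq z_{p+1}$. *)

(* Defs.v *)
From HB Require Import structures.
From mathcomp Require Import all_boot all_order all_algebra.
From mathcomp Require Import all_classical all_reals all_analysis.

Set Implicit Arguments.
Unset Strict Implicit.
Unset Printing Implicit Defensive.

Import Order.TTheory GRing.Theory Num.Theory.
Import numFieldNormedType.Exports.

Local Open Scope classical_set_scope.
Local Open Scope ring_scope.

(* The norm carried by 'rV[R]_N in the library is the sup norm; it induces the
   same topology as the Euclidean norm, so [compact] and [continuous] below are
   the usual notions, but similitudes, distances and diameters are Euclidean. *)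
Definition enorm (R : realType) (N : nat) (x : 'rV[R]_N) : R :=
  Num.sqrt (\sum_(i < N) x ord0 i ^+ 2).

(* The point 0 is added so that the empty set has diameter 0, not -oo. *)
Definition ediam (R : realType) (N : nat) (A : set 'rV[R]_N) : \bar R :=
  ereal_sup ([set 0%E] `|`
    [set (enorm (u.1 - u.2))%:E | u in [set u | A u.1 /\ A u.2]]).

(* |U|^s, with the conventions |set0|^s = 0 and |U|^0 = 1 for U nonempty. *)
Definition hausdorff_gauge (R : realType) (N : nat) (s : R)
    (U : set 'rV[R]_N) : \bar R :=
  if U == set0 then 0%E else (ediam U `^ s)%E.

Definition hausdorff_premeasure (R : realType) (N : nat) (s d : R)
    (A : set 'rV[R]_N) : \bar R :=
  ereal_inf [set (\sum_(0 <= k <oo) hausdorff_gauge s (U k))%E |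
    U in [set U : (set 'rV[R]_N)^nat |
      A `<=` \bigcup_k U k /\ forall k, (ediam (U k) <= d%:E)%E]].

Definition hausdorff_measure (R : realType) (N : nat) (s : R)
    (A : set 'rV[R]_N) : \bar R :=
  ereal_sup [set hausdorff_premeasure s d A | d in [set d : R | 0 < d]].

Definition hausdorff_dim (R : realType) (N : nat)
    (A : set 'rV[R]_N) : \bar R :=
  ereal_inf [set s%:E | s in
    [set s : R | 0 <= s /\ hausdorff_measure s A = 0%E]].

Definition contractive_similitude (R : realType) (N : nat)
    (S : 'rV[R]_N -> 'rV[R]_N) : Prop :=
  exists r : R, [/\ 0 < r, r < 1 &
    forall x y, enorm (S x - S y) = r * enorm (x - y)].

Definition self_similar_set (R : realType) (N l : nat)
    (S : 'I_l -> 'rV[R]_N -> 'rV[R]_N) (L : set 'rV[R]_N) : Prop :=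
  [/\ L !=set0, compact L & L = \bigcup_(i : 'I_l) (S i @` L)].

Definition unit_itv (R : realType) : set R := `[0, 1]%classic.

Definition param_inv (R : realType) (N : nat) (h : R -> 'rV[R]_N) :
  'rV[R]_N -> R := pinv (@unit_itv R) h.

Definition homeo01 (R : realType) (N : nat)
    (h : R -> 'rV[R]_N) (L : set 'rV[R]_N) : Prop :=
  [/\ set_bij (@unit_itv R) L h,
      {within @unit_itv R, continuous h} &
      {within L, continuous (param_inv h)}].

Definition is_arc (R : realType) (N : nat) (L : set 'rV[R]_N) : Prop :=
  exists h : R -> 'rV[R]_N, homeo01 h L.

(* S_1, ..., S_l are indexed here from 0 to l - 1. *)
Definition self_similar_arc (R : realType) (N l : nat)
    (S : 'I_l -> 'rV[R]_N -> 'rV[R]_N) (L : set 'rV[R]_N) : Prop :=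
  [/\ forall i, contractive_similitude (S i),
      self_similar_set S L,
      is_arc L,
      forall i j : 'I_l, `|i - j|%N = 1%N ->
        exists x, (S i @` L) `&` (S j @` L) = [set x] &
      forall i j : 'I_l, (1 < `|i - j|)%N ->
        (S i @` L) `&` (S j @` L) = set0].

Definition oriented_param (R : realType) (N l : nat)
    (S : 'I_l -> 'rV[R]_N -> 'rV[R]_N) (L : set 'rV[R]_N)
    (h : R -> 'rV[R]_N) : Prop :=
  homeo01 h L /\ exists i : 'I_l, i = 0%N :> nat /\ (S i @` L) (h 0).

(* The order on L induced by h; only meaningful for points of L. *)
Definition prec (R : realType) (N : nat) (h : R -> 'rV[R]_N)
    (x y : 'rV[R]_N) : Prop := param_inv h x < param_inv h y.

Definition preceq (R : realType) (N : nat) (h : R -> 'rV[R]_N)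
    (x y : 'rV[R]_N) : Prop := param_inv h x <= param_inv h y.

Definition arc_itv (R : realType) (N : nat) (L : set 'rV[R]_N)
    (h : R -> 'rV[R]_N) (x y : 'rV[R]_N) : set 'rV[R]_N :=
  [set z | [/\ L z, preceq h x z & preceq h z y]].

(* One of the two intervals is empty unless x = y. *)
Definition subarc (R : realType) (N : nat) (L : set 'rV[R]_N)
    (h : R -> 'rV[R]_N) (x y : 'rV[R]_N) : set 'rV[R]_N :=
  arc_itv L h x y `|` arc_itv L h y x.

(* The vertices z_0, ..., z_l; the values z j for j > l are irrelevant. *)
Definition vertices (R : realType) (N l : nat)
    (S : 'I_l -> 'rV[R]_N -> 'rV[R]_N) (L : set 'rV[R]_N)
    (h : R -> 'rV[R]_N) (z : nat -> 'rV[R]_N) : Prop :=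
  [/\ forall j, (j <= l)%N -> L (z j),
      forall j, (j < l)%N -> prec h (z j) (z j.+1) &
      forall j : 'I_l, S j @` L = arc_itv L h (z j) (z j.+1)].

Definition quasi_arc (R : realType) (N : nat) (L : set 'rV[R]_N)
    (h : R -> 'rV[R]_N) (t : R) : Prop :=
  exists lambda : R, 0 < lambda /\
    forall x y, L x -> L y ->
      (ediam (subarc L h x y) `^ t <= (lambda * enorm (x - y))%:E)%E.

(* The vertices are uniquely determined by S, L and h. *)
Definition condition_Q (R : realType) (N l : nat)
    (S : 'I_l -> 'rV[R]_N -> 'rV[R]_N) (L : set 'rV[R]_N)
    (h : R -> 'rV[R]_N) (t : R) (p : nat) : Prop :=
  exists z : nat -> 'rV[R]_N, vertices S L h z /\
    exists C : R, 0 < C /\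
      forall x y, L x -> L y ->
        preceq h (z p.-1) x -> preceq h x (z p) ->
        preceq h (z p) y -> preceq h y (z p.+1) ->
        (ediam (subarc L h x y) `^ t <= (C * enorm (x - y))%:E)%E.

(* Main.v *)
(* Two points of L in different pieces satisfy the quasi-arc estimate with a
   uniform constant: by condition Q if the pieces are adjacent, and because
   disjoint compact pieces are a positive distance apart otherwise. If both
   points lie in the same piece S_i(L), they are pulled back by S_i. Since S_i
   maps subarcs onto subarcs (intermediate value theorem), the pullback divides
   |L(x,y)|^t by r_i^t <= r_i and |x - y| by r_i, so the constant is preserved;
   the distance grows by 1/r_i each time, so the process stops for x <> y. For
   the converse only the existence of the vertices is at stake: the parameters
   of the pieces are nondegenerate segments, each touching the next in one
   point. *)

Require Import Defs.
From HB Require Import structures.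
From mathcomp Require Import all_boot all_order all_algebra.
From mathcomp Require Import all_classical all_reals all_analysis zify lra.

Set Implicit Arguments.
Unset Strict Implicit.
Unset Printing Implicit Defensive.

Import Order.TTheory GRing.Theory Num.Theory.
Import numFieldNormedType.Exports.

Local Open Scope classical_set_scope.
Local Open Scope ring_scope.

(** * Euclidean norm and diameter, compared with the sup norm of the library *)

Section Euclidean.
Variables (R : realType) (N : nat).
Implicit Types x y : 'rV[R]_N.

Lemma enorm_ge0 x : 0 <= enorm x.
Proof. exact: sqrtr_ge0. Qed.

Lemma enormN x : enorm (- x) = enorm x.
Proof. by congr Num.sqrt; apply: eq_bigr => i _; rewrite mxE sqrrN. Qed.

Lemma enormB x y : enorm (x - y) = enorm (y - x).
Proof. by rewrite -enormN opprB. Qed.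

Lemma enorm0 : enorm (0 : 'rV[R]_N) = 0.
Proof. by rewrite /enorm big1 ?sqrtr0// => i _; rewrite mxE expr0n. Qed.

(** The sup norm is attained at one coordinate, whose square is a single term of the sum under the
    root. *)
Lemma mx_norm_le_enorm x : `|x| <= enorm x.
Proof.
rewrite -[leLHS]/(mx_norm x).
have [->|/mx_norm_neq0[[i j] ->]] := eqVneq (mx_norm x) 0.
  exact: enorm_ge0.
rewrite /= (ord1 i) -sqrtr_sqr ler_wsqrtr//= (bigD1 j)//= lerDl.
by apply: sumr_ge0 => k _; exact: sqr_ge0.
Qed.

Lemma enorm_eq0 x : enorm x = 0 -> x = 0.
Proof.
move=> x0; apply/normr0_eq0/le_anti.
by rewrite -{1}x0 mx_norm_le_enorm normr_ge0.
Qed.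

Lemma enorm_gt0 x : x != 0 -> 0 < enorm x.
Proof.
move=> x0; rewrite lt0r enorm_ge0 andbT.
by apply: contra x0 => /eqP/enorm_eq0 ->.
Qed.

Lemma enorm_continuous : continuous (@enorm R N).
Proof.
have sq : continuous (fun x : 'rV[R]_N => \sum_(i < N) x ord0 i ^+ 2).
  apply: continuous_big => [|i _ x]; first exact: add_continuous.
  apply: (@continuous_comp _ _ _
    (fun x : 'rV[R]_N => x ord0 i) (fun y : R => y ^+ 2)).
    exact: coord_continuous.
  exact: exprn_continuous.
by move=> x; apply: continuous_comp (sq x) (@sqrt_continuous _ _).
Qed.

(** Continuity refers to the sup norm, the ratio to the Euclidean one. The Euclidean distance to [x]
    is continuous, hence small near [x], and it dominates the sup norm after applying [S]. *)
Lemma similitude_continuous (S : 'rV[R]_N -> 'rV[R]_N) :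
  contractive_similitude S -> continuous S.
Proof.
move=> [r [r0 r1 Sr]] x.
apply/(@cvgrPdist_lt _ 'rV[R]_N _ (nbhs x) (nbhs_filter x)) => e e0.
have : continuous (fun y : 'rV[R]_N => enorm (x - y)).
  move=> y; apply: continuous_comp; last exact: enorm_continuous.
  apply: (@continuousB _ 'rV[R]_N 'rV[R]_N); last by move=> ?.
  exact: cst_continuous.
move=> /(_ x)/(@cvgrPdist_lt _ R _ (nbhs x) (nbhs_filter x))/(_ e e0).
rewrite subrr enorm0; apply: filterS => y.
rewrite sub0r normrN ger0_norm ?enorm_ge0// => xy.
apply: le_lt_trans (mx_norm_le_enorm _) _.
by rewrite Sr; apply: le_lt_trans xy; rewrite ler_piMl ?enorm_ge0// ltW.
Qed.

Lemma ediam_powR_le (t c : R) (A : set 'rV[R]_N) : 0 < t -> 0 <= c ->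
  (forall u v, A u -> A v -> enorm (u - v) `^ t <= c) <->
  (ediam A `^ t <= c%:E)%E.
Proof.
move=> t0 c0; split=> [Ac|Ac u v Au Av].
  have Acd : (ediam A <= (c `^ t^-1)%:E)%E.
    apply: ge_ereal_sup => _ [->|[[u v] /= [Au Av] <-]].
      by rewrite lee_fin powR_ge0.
    rewrite lee_fin -[leLHS]powRr1 ?enorm_ge0// -(mulfV (lt0r_neq0 t0)) powRrM.
    by rewrite ge0_ler_powR ?nnegrE ?powR_ge0 ?invr_ge0 ?(ltW t0)// Ac.
  have A0 : (0 <= ediam A)%E by apply: ereal_sup_ubound; left.
  apply: (@le_trans _ _ ((c `^ t^-1)%:E `^ t)%E).
    by rewrite gt0_ler_poweR ?(ltW t0)// in_itv/= ?A0 ?leey// lee_fin powR_ge0.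
  by rewrite poweR_EFin lee_fin -powRrM mulVf ?lt0r_neq0// powRr1.
rewrite -lee_fin -poweR_EFin; apply: le_trans Ac.
have uvA : ((enorm (u - v))%:E <= ediam A)%E.
  by apply: ereal_sup_ubound; right; exists (u, v).
have uv0 : (0 <= (enorm (u - v))%:E)%E by rewrite lee_fin enorm_ge0.
by rewrite gt0_ler_poweR ?(ltW t0)// in_itv/= ?leey ?andbT// (le_trans uv0).
Qed.

End Euclidean.

(** * Parametrised arcs, their subarcs, and maps of the arc into itself *)

Lemma within_continuous_comp_sub {T U V : topologicalType} (A : set T)
    (B : set U) (f : T -> U) (g : U -> V) :
  (forall x, A x -> B (f x)) ->
  {within A, continuous f} -> {within B, continuous g} ->
  {within A, continuous g \o f}.
Proof.
move=> AB /subspace_continuousP cf /subspace_continuousP cg.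
apply/subspace_continuousP => x Ax W /(cg _ (AB _ Ax)) /(cf _ Ax) fW.
have : \forall y \near x, A y -> B (f y) -> W (g (f y)) := fW.
apply: (@filterS _ (nbhs x) (nbhs_filter x)) => y AW Ay.
by apply: AW => //; exact: AB.
Qed.

Section Arc.
Variables (R : realType) (N : nat) (L : set 'rV[R]_N) (h : R -> 'rV[R]_N).
Hypothesis hL : homeo01 h L.
Let g := param_inv h.

Lemma param_in s : `[0, 1]%classic s -> L (h s).
Proof. by case: hL => [[hf _ _] _ _]; exact: hf. Qed.

Lemma paramK s : `[0, 1]%classic s -> g (h s) = s.
Proof.
by move=> s01; case: hL => [[_ hi _] _ _]; apply: (pinvKV _ hi); rewrite inE.
Qed.

Lemma param_inv_in x : L x -> `[0, 1]%classic (g x).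
Proof.
by case: hL => [[_ _ hs] _ _] /hs[s s01 <-]; rewrite paramK.
Qed.

Lemma param_invK x : L x -> h (g x) = x.
Proof.
by case: hL => [[_ _ hs] _ _] /hs[s s01 <-]; rewrite paramK.
Qed.

Lemma subarcE x y u : subarc L h x y u <->
  L u /\ Num.min (g x) (g y) <= g u <= Num.max (g x) (g y).
Proof.
rewrite /subarc /arc_itv /preceq -/g; split.
  by case=> -[Lu xu uy]; rewrite ge_min le_max xu uy ?orbT.
by move=> [Lu]; case: (leP (g x) (g y)) => xy /andP[? ?]; [left|right].
Qed.

Lemma subarcC x y : subarc L h x y = subarc L h y x.
Proof. exact: setUC. Qed.

Lemma subarcxx x u : L x -> subarc L h x x u -> u = x.
Proof.
by move=> Lx /subarcE[Lu]; rewrite minxx maxxx => /le_anti gxu;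
  rewrite -(param_invK Lu) -gxu param_invK.
Qed.

Section PieceMap.
Variable S : 'rV[R]_N -> 'rV[R]_N.
Hypotheses (Sc : continuous S) (SL : forall x, L x -> L (S x)).

Lemma param_conj_continuous :
  {within `[0, 1]%classic, continuous (g \o S \o h)}.
Proof.
have [_ hc gc] := hL.
apply: within_continuous_comp_sub hc _; first exact: param_in.
apply: within_continuous_comp_sub gc; first exact: SL.
exact: continuous_subspaceT.
Qed.

(** The intermediate value theorem for [g \o S \o h], the map [S] read in the parameter, on the
    segment between [g x] and [g y]. *)
Lemma subarc_pullback x y u : L x -> L y ->
  subarc L h (S x) (S y) u -> exists2 v, subarc L h x y v & S v = u.
Proof.
wlog xy : x y / g x <= g y.
  move=> H Lx Ly; have [xy|/ltW yx] := leP (g x) (g y); first exact: H.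
  by rewrite subarcC (subarcC x); exact: H.
move=> Lx Ly /subarcE[Lu guxy].
have := param_inv_in Lx; have := param_inv_in Ly.
rewrite /= !in_itv/= => /andP[y0 y1] /andP[x0 x1].
have xy01 : `[g x, g y] `<=` `[0, 1].
  move=> s; rewrite /= !in_itv/= => /andP[xs sy].
  by rewrite (le_trans x0)// (le_trans sy).
have [||s sxy fs] := @IVT R (g \o S \o h) (g x) (g y) (g u) xy.
- exact: continuous_subspaceW param_conj_continuous.
- by rewrite /= !param_invK.
have s01 := xy01 _ sxy.
exists (h s); last first.
  by rewrite -[RHS]param_invK// -fs /= param_invK//; exact/SL/param_in.
apply/subarcE; split; first exact: param_in.
by rewrite paramK// (min_idPl xy) (max_idPr xy); move: sxy; rewrite in_itv.
Qed.

(** [S] read in the parameter is continuous on [0, 1], so its range is the segment from its minimum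
    to its maximum. *)
Lemma piece_arc_itv : {in L &, injective S} ->
  exists a b, [/\ 0 <= a, a < b, b <= 1 &
    S @` L = [set x | L x /\ a <= g x <= b]].
Proof.
move=> Si; set f := g \o S \o h.
have fc : {within `[0, 1], continuous f} := param_conj_continuous.
have f01 s : s \in `[0, 1] -> f s \in `[0, 1].
  by move=> s01; apply: param_inv_in; exact/SL/param_in.
have [s s01 smin] := EVT_min ler01 fc.
have [s' s'01 smax] := EVT_max ler01 fc.
exists (f s), (f s'); split.
- by have := f01 _ s01; rewrite in_itv => /andP[].
- have i0 : (0 : R) \in `[0, 1] by rewrite in_itv/= lexx ler01.
  have i1 : (1 : R) \in `[0, 1] by rewrite in_itv/= lexx ler01.
  (* If minimum and maximum agreed, [f] would be constant and [S] would identify the two ends of the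
     arc. *)
  rewrite lt_neqAle smin// andbT; apply/eqP => ss'.
  have f0 : f 0 = f 1.
    have e r : r \in `[0, 1] -> f r = f s.
      by move=> r01; apply/le_anti; rewrite smin// {1}ss' smax.
    by rewrite !e.
  have /Si : S (h 0) = S (h 1).
    by rewrite -[LHS]param_invK ?[in LHS](f0 : g _ = _) /= ?param_invK//;
      exact/SL/param_in.
  rewrite !inE => /(_ (param_in i0) (param_in i1))/(congr1 g).
  by rewrite !paramK// => /esym/eqP; rewrite oner_eq0.
- by have := f01 _ s'01; rewrite in_itv => /andP[].
apply/seteqP; split=> [_ [x Lx <-]|u [Lu guab]].
  split; first exact: SL.
  have := param_inv_in Lx; rewrite -{2 3}(param_invK Lx) => gx01.
  by rewrite (smin (g x))// (smax (g x)).
(* The minimum may be attained before or after the maximum, hence the unordered segment between [s]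
   and [s']. *)
have ss01 : `[Num.min s s', Num.max s s'] `<=` `[0, 1].
  move=> r; move: s01 s'01; rewrite /= !in_itv/=.
  rewrite ge_min le_max => /andP[? ?] /andP[? ?] /andP[/orP[] ? /orP[] ?]; lra.
have [|||r rs fr] := @IVT R f (Num.min s s') (Num.max s s') (g u).
- by rewrite ge_min le_max lexx.
- exact: continuous_subspaceW fc.
- have [ss'|ss'] := leP s s'; last rewrite minC maxC.
    by rewrite (min_idPl _) ?(max_idPr _) ?smin ?smax.
  by rewrite (min_idPl _) ?(max_idPr _) ?smin ?smax.
have r01 := ss01 _ rs.
exists (h r); first exact: param_in.
by rewrite -[RHS]param_invK// -fr /f /= param_invK//; exact/SL/param_in.
Qed.

End PieceMap.

End Arc.

(** * Pieces of a self-similar arc and their vertices *)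

Lemma similitude_inj (R : realType) (N : nat) (S : 'rV[R]_N -> 'rV[R]_N) :
  contractive_similitude S -> injective S.
Proof.
move=> [r [r0 _ Sr]] x y Sxy; apply/eqP; rewrite -subr_eq0; apply/eqP.
apply: enorm_eq0; have := Sr x y; rewrite Sxy subrr enorm0 => /esym/eqP.
by rewrite mulf_eq0 (gt_eqF r0) => /eqP.
Qed.

Lemma self_similar_piece_sub (R : realType) (N l : nat)
    (S : 'I_l -> 'rV[R]_N -> 'rV[R]_N) (L : set 'rV[R]_N) i x :
  self_similar_set S L -> L x -> L (S i x).
Proof. by move=> [_ _ LS] Lx; rewrite LS; exists i => //; exists x. Qed.

(** The first segment starts at 0, so the second can only continue it to the right; disjointness of
    pieces two apart forbids turning back later. The ends of the segments are then the vertices. *)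
Lemma vertices_exist (R : realType) (N l : nat)
    (S : 'I_l -> 'rV[R]_N -> 'rV[R]_N) (L : set 'rV[R]_N)
    (h : R -> 'rV[R]_N) :
  self_similar_arc S L -> oriented_param S L h -> exists z, vertices S L h z.
Proof.
move=> [Sc SL _ adj nadj] [hL [i0 [i00 Sh0]]].
case: l S i0 i00 Sc SL adj nadj Sh0 => [S [] //|l S i0 i00 Sc SL adj nadj Sh0].
have piece i : exists ab : R * R, [/\ 0 <= ab.1, ab.1 < ab.2, ab.2 <= 1 &
    S i @` L = [set x | L x /\ ab.1 <= param_inv h x <= ab.2]].
  have [|x Lx|x y _ _|a [b abP]] := piece_arc_itv hL (S := S i).
  - exact: similitude_continuous.
  - exact: self_similar_piece_sub SL Lx.
  - exact: similitude_inj (Sc i) x y.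
  by exists (a, b).
have [ab abP] := choice piece.
(* Past the last index [inord] falls back to piece 0, so the bounds on [a] and [b] hold for every
   natural number. *)
pose a i := (ab (inord i)).1; pose b i := (ab (inord i)).2.
have a_ge0 i : 0 <= a i by case: (abP (inord i)).
have a_lt_b i : a i < b i by case: (abP (inord i)).
have b_le1 i : b i <= 1 by case: (abP (inord i)).
have pieceE i : S (inord i) @` L =
    [set x | L x /\ a i <= param_inv h x <= b i] by case: (abP (inord i)).
have in01 i s : a i <= s -> s <= b i -> `[0, 1]%classic s.
  move=> ai bi; rewrite /= in_itv/= (le_trans (a_ge0 i))//.
  exact: le_trans (b_le1 i).
have in_piece i s : a i <= s -> s <= b i -> (S (inord i) @` L) (h s).
  move=> ai bi; have s01 := in01 _ _ ai bi.
  by rewrite pieceE; split; [exact: param_in hL _ s01|rewrite (paramK hL)// ai].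
have a0 : a 0%N = 0.
  have i0E : inord 0 = i0 by apply: val_inj; rewrite /= inordK.
  move: Sh0; rewrite -i0E pieceE => -[_]; rewrite (paramK hL); last first.
    by rewrite /= in_itv/= lexx ler01.
  by move=> /andP[a00 _]; apply/le_anti; rewrite a00 a_ge0.
have touch i : (i.+1 < l.+1)%N -> b i = a i.+1 \/ b i.+1 = a i.
  move=> il.
  have [|x Sx] := adj (inord i) (inord i.+1).
    by rewrite !inordK//; lia.
  have : [set x] x by [].
  rewrite -Sx !pieceE => -[[Lx /andP[ax xb]] [_ /andP[ax' xb']]].
  have only s : a i <= s -> s <= b i -> a i.+1 <= s -> s <= b i.+1 ->
      s = param_inv h x.
    move=> ais sbi ais' sbi'.
    have : [set x] (h s) by rewrite -Sx; split; apply: in_piece.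
    by move=> <-; rewrite (paramK hL)//; exact: in01 ais sbi.
  have ab0 := a_lt_b i; have ab' := a_lt_b i.+1.
  have a'b := le_trans ax' xb; have ab'' := le_trans ax xb'.
  have only2 c d : a i <= c <= b i -> a i.+1 <= c <= b i.+1 ->
      a i <= d <= b i -> a i.+1 <= d <= b i.+1 -> c = d.
    move=> /andP[? ?] /andP[? ?] /andP[? ?] /andP[? ?].
    by rewrite (only c)// (only d).
  (* Four relative positions: an overlap is a common segment, so it shrinks to a shared end; a
     nested segment would be degenerate. *)
  have [aa|/ltW aa] := leP (a i) (a i.+1);
    have [bb|/ltW bb] := leP (b i) (b i.+1).
  - by left; apply: only2; apply/andP; split=> //; exact: ltW.
  - suff e : a i.+1 = b i.+1 by rewrite e ltxx in ab'.
    by apply: only2; apply/andP; split=> //; exact: ltW.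
  - suff e : a i = b i by rewrite e ltxx in ab0.
    by apply: only2; apply/andP; split=> //; exact: ltW.
  - by right; apply: only2; apply/andP; split=> //; exact: ltW.
(* The other alternative at [i.+1] would put [a i.+1] in both pieces [i] and
   [i.+2]. *)
have chain i : (i.+1 < l.+1)%N -> b i = a i.+1.
  elim: i => [|i IH] il.
    by case: (touch _ il) => // b1; have := a_lt_b 1%N; have := a_ge0 1%N; lra.
  case: (touch _ il) => // bai; have bi := IH (ltnW il).
  have : set0 (h (a i.+1)).
    rewrite -(nadj (inord i) (inord i.+2)); last by rewrite !inordK//; lia.
    split; apply: in_piece; [by rewrite -bi ltW|by rewrite bi| |by rewrite bai].
    by rewrite -bai ltW.
  by [].
(* Vertices as right ends of the preceding pieces; by [chain], those before the last are also left
   ends. *)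
pose z j := if j is i.+1 then h (b i) else h (a 0%N).
have za j : (j < l.+1)%N -> z j = h (a j).
  by case: j => // j jl; rewrite /= chain.
have a01 j : `[0, 1]%classic (a j) by apply: (in01 j) => //; exact: ltW.
have b01 j : `[0, 1]%classic (b j) by apply: (in01 j) => //; exact: ltW.
exists z; split.
- by case=> [|j] _; apply: (param_in hL).
- by move=> j jl; rewrite /prec za// /z !(paramK hL).
- move=> j; rewrite -[j in LHS]inord_val pieceE za// /z /arc_itv /preceq.
  rewrite !(paramK hL)//; apply/seteqP; split=> x.
    by move=> [Lx /andP[]].
  by move=> [Lx ? ?]; split=> //; apply/andP.
Qed.

(** * Compactness bounds on distances *)

Lemma enorm_sub_continuous (R : realType) (N : nat)
    (f g : 'rV[R]_N -> 'rV[R]_N) : continuous f -> continuous g ->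
  continuous (fun u : 'rV[R]_N * 'rV[R]_N => enorm (f u.1 - g u.2)).
Proof.
move=> fc gc u; apply: continuous_comp; last exact: enorm_continuous.
apply: (@continuousB _ 'rV[R]_N ('rV[R]_N * 'rV[R]_N)%type).
  by apply: continuous_comp; [exact: cvg_fst|exact: fc].
by apply: continuous_comp; [exact: cvg_snd|exact: gc].
Qed.

Lemma compact_enorm_sub_bounded (R : realType) (N : nat) (L : set 'rV[R]_N) :
  compact L -> L !=set0 ->
  exists2 D, 0 < D & forall x y, L x -> L y -> enorm (x - y) <= D.
Proof.
move=> cL [x0 Lx0].
have [|?|?|/= u _ umax] := compact_EVT_max _ (compact_setX cL cL)
    (continuous_subspaceT (enorm_sub_continuous (f := id) (g := id) _ _)).
- by exists (x0, x0).
- exact: cvg_id.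
- exact: cvg_id.
(* Adding 1 keeps the bound positive even when the maximal distance is 0. *)
exists (enorm (u.1 - u.2) + 1).
  by rewrite ltr_wpDl// enorm_ge0.
by move=> x y Lx Ly; rewrite ler_wpDr// (umax (x, y))// inE; split.
Qed.

(** The distance attains its minimum over [L] times [L], and a zero minimum would give a common
    point of the images. *)
Lemma disjoint_images_far (R : realType) (N : nat) (L : set 'rV[R]_N)
    (f g : 'rV[R]_N -> 'rV[R]_N) :
  compact L -> L !=set0 -> continuous f -> continuous g ->
  (f @` L) `&` (g @` L) = set0 ->
  exists2 d, 0 < d & forall x y, L x -> L y -> d <= enorm (f x - g y).
Proof.
move=> cL [x0 Lx0] fc gc fg0.
have [|/= u uL umin] := compact_EVT_min _ (compact_setX cL cL)
    (continuous_subspaceT (enorm_sub_continuous fc gc)).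
  by exists (x0, x0).
exists (enorm (f u.1 - g u.2)); last first.
  by move=> x y Lx Ly; apply: (umin (x, y)); rewrite inE; split.
apply: enorm_gt0; rewrite subr_eq0; apply/eqP => fgu.
move: uL; rewrite inE => -[Lu1 Lu2].
suff : set0 (f u.1) by [].
by rewrite -fg0; split; [exists u.1|rewrite fgu; exists u.2].
Qed.

(** * The quasi-arc estimate for one pair of points *)

(** Stated on pairs of points of the subarc, so that it can be pulled back pointwise;
    [subarc_boundP] returns to the diameter. *)
Definition subarc_bound (R : realType) (N : nat) (L : set 'rV[R]_N)
    (h : R -> 'rV[R]_N) (t lambda : R) (x y : 'rV[R]_N) : Prop :=
  forall u v, subarc L h x y u -> subarc L h x y v ->
    enorm (u - v) `^ t <= lambda * enorm (x - y).

Lemma subarc_boundP (R : realType) (N : nat) (L : set 'rV[R]_N)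
    (h : R -> 'rV[R]_N) (t lambda : R) (x y : 'rV[R]_N) :
  0 < t -> 0 <= lambda ->
  subarc_bound L h t lambda x y <->
  (ediam (subarc L h x y) `^ t <= (lambda * enorm (x - y))%:E)%E.
Proof.
by move=> t0 l0; apply: ediam_powR_le => //; rewrite mulr_ge0 ?enorm_ge0.
Qed.

Lemma subarc_boundC (R : realType) (N : nat) (L : set 'rV[R]_N)
    (h : R -> 'rV[R]_N) (t lambda : R) (x y : 'rV[R]_N) :
  subarc_bound L h t lambda x y -> subarc_bound L h t lambda y x.
Proof. by rewrite /subarc_bound subarcC enormB. Qed.

(* t >= 1 enters here: [r `^ t <= r] for the ratio r < 1. *)
Lemma subarc_bound_similitude (R : realType) (N : nat) (L : set 'rV[R]_N)
    (h : R -> 'rV[R]_N) (S : 'rV[R]_N -> 'rV[R]_N) (t lambda : R) x y :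
  homeo01 h L -> contractive_similitude S -> (forall x, L x -> L (S x)) ->
  1 <= t -> 0 <= lambda -> L x -> L y ->
  subarc_bound L h t lambda x y -> subarc_bound L h t lambda (S x) (S y).
Proof.
move=> hL Sc SL t1 l0 Lx Ly xyb.
have St := similitude_continuous Sc.
move=> u' v' /(subarc_pullback hL St SL Lx Ly)[u xyu <-].
move=> /(subarc_pullback hL St SL Lx Ly)[v xyv <-] {u' v'}.
have [r [r0 r1 Sr]] := Sc.
rewrite !Sr powRM ?enorm_ge0 ?(ltW r0)// mulrCA.
apply: ler_pM; rewrite ?powR_ge0//; last exact: xyb.
rewrite -[leRHS]powRr1 ?(ltW r0)//.
by rewrite ger_powR ?r0 ?(ltW r1).
Qed.

Lemma subarc_bound_pieces (R : realType) (N l : nat) (t : R)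
    (S : 'I_l -> 'rV[R]_N -> 'rV[R]_N) (L : set 'rV[R]_N)
    (h : R -> 'rV[R]_N) (i j : 'I_l) :
  0 < t -> self_similar_arc S L ->
  (forall p : nat, (1 <= p <= l.-1)%N -> condition_Q S L h t p) ->
  i != j ->
  exists2 lambda, 0 < lambda & forall x y, L x -> L y ->
    subarc_bound L h t lambda (S i x) (S j y).
Proof.
move=> t0 [Sc SL _ _ nadj] Q.
wlog ij : i j / (i < j)%N.
  move=> H; rewrite neq_ltn => /orP[ij|ji].
    by apply: H => //; rewrite neq_ltn ij.
  have [|la la0 lab] := H _ _ ji; first by rewrite neq_ltn ji.
  by exists la => // x y Lx Ly; apply/subarc_boundC/lab.
move=> _.
have [cL L0] : compact L /\ L !=set0 by case: SL.
have Lsub k x : L x -> L (S k x) by exact: self_similar_piece_sub SL.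
have [ij1|ij1] := eqVneq (j : nat) i.+1.
  (* With pieces counted from 0, pieces [j - 1] and [j] meet at the vertex [z j], so Condition Q
     applies with [p = j]. *)
  have jp : (1 <= j <= l.-1)%N by rewrite ij1/=; have := ltn_ord j; lia.
  have [z [[_ _ zE] [C [C0 CQ]]]] := Q _ jp.
  exists C => // x y Lx Ly; apply/(subarc_boundP _ _ _ _ t0 (ltW C0)).
  have : (S i @` L) (S i x) by exists x.
  have : (S j @` L) (S j y) by exists y.
  rewrite !zE => -[Ljy zj jz] [Lix zi iz].
  by apply: CQ => //; rewrite ?ij1//= -ij1.
have [|d d0 dS] := disjoint_images_far cL L0
    (similitude_continuous (Sc i)) (similitude_continuous (Sc j)).
  by apply: nadj; lia.
have [D D0 DL] := compact_enorm_sub_bounded cL L0.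
(* [D] bounds every distance in [L], and [d] bounds from below the distance between the two
   pieces. *)
exists (D `^ t / d); first by rewrite divr_gt0// powR_gt0.
move=> x y Lx Ly u v xyu xyv.
apply: (@le_trans _ _ (D `^ t)).
  have [Lu Lv] : L u /\ L v by case: xyu => -[? _ _]; case: xyv => -[? _ _].
  by rewrite ge0_ler_powR ?nnegrE ?enorm_ge0 ?(ltW t0) ?(ltW D0)// DL.
by rewrite -mulrA ler_peMr ?powR_ge0// ler_pdivlMl// mulr1 dS.
Qed.

Theorem proposition4p4 (R : realType) (N l : nat) (t s : R)
    (S : 'I_l -> 'rV[R]_N -> 'rV[R]_N) (L : set 'rV[R]_N)
    (h : R -> 'rV[R]_N) :
  1 <= t ->
  self_similar_arc S L ->
  oriented_param S L h ->
  hausdorff_dim L = s%:E ->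
  1 < s ->
  quasi_arc L h t <->
  (forall p : nat, (1 <= p <= l.-1)%N -> condition_Q S L h t p).
Proof.
move=> t1 SL hL _ _; have t0 : 0 < t by exact: lt_le_trans t1.
split=> [[la [la0 laP]] p _|Q].
  have [z zP] := vertices_exist SL hL.
  exists z; split=> //; exists la; split=> // x y Lx Ly _ _ _ _.
  exact: laP.
have [Sc sS _ _ _] := SL.
have [h01 _] := hL.
have [L0 cL LS] := sS.
have Lsub k x : L x -> L (S k x) by exact: self_similar_piece_sub sS.
have [D D0 DL] := compact_enorm_sub_bounded cL L0.
have pieces (ij : 'I_l * 'I_l) : exists la, 0 < la /\ (ij.1 != ij.2 ->
    forall x y, L x -> L y -> subarc_bound L h t la (S ij.1 x) (S ij.2 y)).
  have [e|ne] := eqVneq ij.1 ij.2; first by exists 1; split.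
  by have [la] := subarc_bound_pieces t0 SL Q ne; exists la.
have [la laP] := choice pieces.
(* A sum of nonnegative terms dominates each of them, which gives one constant for all pairs of
   pieces. *)
pose La := 1 + \sum_ij la ij.
have laLa ij : la ij <= La.
  rewrite /La (bigD1 ij)//= addrCA lerDl addr_ge0// sumr_ge0// => k _.
  by rewrite ltW//; case: (laP k).
have La0 : 0 < La.
  by rewrite ltr_wpDr// sumr_ge0// => k _; rewrite ltW//; case: (laP k).
have ratio k : exists r, [/\ 0 < r, r < 1 &
    forall x y, enorm (S k x - S k y) = r * enorm (x - y)] := Sc k.
have [r rP] := choice ratio.
(* The largest ratio: a maximum of finitely many numbers below 1, hence itself below 1. *)
pose q := \big[Num.max/0]_k r k.
have q0 : 0 <= q.
  rewrite /q; elim/big_ind: _ => // [x y x0 y0|k _]; first by rewrite le_max x0.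
  by case: (rP k) => /ltW.
have q1 : q < 1.
  rewrite /q; elim/big_ind: _ => // [x y x0 y0|k _]; first by rewrite gt_max x0.
  by case: (rP k).
have rq k : r k <= q by exact: le_bigmax.
exists La; split=> // x y Lx Ly; apply/(subarc_boundP _ _ _ _ t0 (ltW La0)).
have [->|xy] := eqVneq x y.
  move=> u v /(subarcxx h01 Ly) -> /(subarcxx h01 Ly) ->.
  by rewrite !subrr enorm0 mulr0 powR0// lt0r_neq0.
(* [n] limits the number of pullbacks: each one multiplies the distance by at least [1 / q], and no
   distance in [L] exceeds [D]. *)
have [n Dn] : exists n, D * q ^+ n < enorm (x - y).
  have xy0 : 0 < enorm (x - y) by rewrite enorm_gt0// subr_eq0.
  have qn : geometric D q @ \oo --> 0.
    by apply: cvg_geometric; rewrite ger0_norm.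
  have /cvgrPdist_lt/(_ _ xy0)[n _ /(_ n (leqnn n))] := qn.
  rewrite sub0r normrN /= ger0_norm => [Dn|]; first by exists n.
  by rewrite mulr_ge0 ?exprn_ge0 ?(ltW D0).
elim: n x y Lx Ly xy Dn => [|n IH] x y Lx Ly xy.
  by rewrite expr0 mulr1 ltNge DL.
move=> Dq.
have := Lx; rewrite {1}LS => -[i _ [x' Lx' xE]].
have := Ly; rewrite {1}LS => -[j _ [y' Ly' yE]].
rewrite -xE -yE in xy Dq *.
(* Distinct pieces end the descent with the constant [la (i, j)]; a common piece calls the induction
   hypothesis on the preimages. *)
have [ij|ij] := eqVneq i j; last first.
  have [_ /(_ ij _ _ Lx' Ly') b] := laP (i, j).
  move=> u v xu yv; apply: le_trans (b u v xu yv) _.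
  by rewrite ler_wpM2r ?enorm_ge0.
rewrite -ij in xy Dq *.
apply: subarc_bound_similitude => //; [exact: Lsub|exact: ltW|].
apply: IH => //; first by apply: contra xy => /eqP ->.
have [r0 r1 rE] := rP i.
rewrite rE exprSr mulrA in Dq.
have xy'0 : 0 < enorm (x' - y').
  apply: enorm_gt0; rewrite subr_eq0; apply: contra xy => /eqP ->.
  by [].
(* After multiplication by [r i], the goal follows from [Dq] because [r i <= q]. *)
rewrite -(ltr_pM2l r0); apply: le_lt_trans Dq.
by rewrite mulrC ler_wpM2l ?rq// mulr_ge0 ?exprn_ge0 ?(ltW D0).
Qed.
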